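(* Fix $\epsilon,\eta>0$ and the dimension $n\ge2$. There is a constant $c_{n,\epsilon,\eta}>0$, depending only on $n,\epsilon,\eta$, such that the following holds. Let $A\ge1$ and let $N\ge2$ be an integer with $N\ge A$. For any continuously differentiable function $f$ on $[0,1]^n$ satisfying $$\min_{[0,1]^n}f>0,\qquad \sup_{x\in[0,1]^n,\ i=1,\dots,n}|\partial_i\log f(x)|\le A,$$ $$f(x+t(y-x))\ge\epsilon\min\{f(x),f(y)\}\quad\text{for all }x,y\in[0,1]^n,\ t\in[0,1],$$ and $$\eta\|f\|_\infty\le\int_{[0,1]^n}f(x)\,dx,$$ the spectral gap $\lambda$ of the Metropolis chain on $B_N=\{1,\dots,N\}^n$ associated with $f$ satisfies $$\lambda\ge\frac{c_{n,\epsilon,\eta}}{N^2}.$$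
   Context: Given a positive function $f$ on $[0,1]^n$ and an integer $N$, define on $B_N=\{1,\dots,N\}^n$ the function $F_N(x)=f\left(\left(N^{-1}(x_i-1/2)\right)_{i=1}^n\right)$ and the probability measure $\pi=F_N/\sum_{B_N}F_N$. The associated Metropolis chain (with proposal the simple random walk on the grid with holding at the boundary) is the Markov kernel $M$ on $B_N$ given by $M(x,y)=\frac1{2n}\min\{1,F_N(y)/F_N(x)\}$ if $\sum_i|x_i-y_i|=1$, $M(x,y)=0$ if $\sum_i|x_i-y_i|>1$, and $M(x,x)=1-\sum_{y\ne x}M(x,y)$. It is reversible with respect to $\pi$. The spectral gap is $\lambda=1-\beta_1$, where $\beta_1$ is the second largest eigenvalue of $M$ acting on $L^2(B_N,\pi)$. $\|f\|_\infty$ is the supremum norm on $[0,1]^n$. *)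

(* Defs.v *)
From HB Require Import structures.
From mathcomp Require Import all_boot all_order all_algebra.
From mathcomp Require Import all_classical all_reals all_analysis.
From mathcomp Require Import polyrcf.

Set Implicit Arguments.
Unset Strict Implicit.
Unset Printing Implicit Defensive.

Import Order.TTheory GRing.Theory Num.Theory.
Import numFieldNormedType.Exports.

Local Open Scope classical_set_scope.
Local Open Scope ring_scope.

(* Lebesgue measure on R^n (as n-tuples with the product sigma-algebra), built
   as the image of lebesgue_measure \x (Lebesgue measure on R^(n-1)) under
   consing; R^0 carries the unit point mass. *)
Section lebesgue_tuple.
Context {R : realType}.
Local Notation T := (measurableTypeR R).

Definition cons_pair (n : nat) (p : T * n.-tuple T) : n.+1.-tuple T :=
  [tuple of p.1 :: p.2].

Lemma measurable_cons_pair n : measurable_fun setT (@cons_pair n).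
Proof. exact: measurable_cons measurable_fst measurable_snd. Qed.

Section step.
Context (n : nat) (m : {sigma_finite_measure set (n.-tuple T) -> \bar R}).

Definition lebesgue_cons : set (n.+1.-tuple T) -> \bar R :=
  pushforward (lebesgue_measure \x m)%E (@cons_pair n).

Let lebesgue_cons0 : lebesgue_cons set0 = 0%E.
Proof. by rewrite /lebesgue_cons /pushforward preimage_set0 measure0. Qed.

Let lebesgue_cons_ge0 A : (0 <= lebesgue_cons A)%E.
Proof. by rewrite /lebesgue_cons /pushforward measure_ge0. Qed.

Let lebesgue_cons_sigma_additive : semi_sigma_additive lebesgue_cons.
Proof.
move=> F mF tF mUF; rewrite /lebesgue_cons /pushforward preimage_bigcup.
have mp A : measurable A -> measurable (@cons_pair n @^-1` A).
  by move=> mA; rewrite -[_ @^-1` _]setTI; exact: measurable_cons_pair.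
apply: measure_semi_sigma_additive; first by move=> k; apply: mp.
  apply/trivIsetP => /= i j _ _ ij; rewrite -preimage_setI.
  by move/trivIsetP : tF => /(_ _ _ _ _ ij) ->//; rewrite preimage_set0.
by rewrite -preimage_bigcup; exact: mp.
Qed.

HB.instance Definition _ := isMeasure.Build _ _ _ lebesgue_cons
  lebesgue_cons0 lebesgue_cons_ge0 lebesgue_cons_sigma_additive.

Let lebesgue_cons_sigma_finite : sigma_finite setT lebesgue_cons.
Proof.
have /sigma_finiteP[F [TF ndF Foo]] := sigma_finiteT (@lebesgue_measure R).
have /sigma_finiteP[G [TG ndG Goo]] := sigma_finiteT m.
pose g (t : n.+1.-tuple T) : T * n.-tuple T := (thead t, [tuple of behead t]).
have mg : measurable_fun setT g.
  apply/measurable_fun_pair; first exact: measurable_tnth.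
  exact: measurable_behead.
have gK p : g (cons_pair p) = p.
  by case: p => a b; rewrite /g; congr pair; exact/val_inj.
exists (fun i => g @^-1` (F i `*` G i)).
  apply/seteqP; split => // t _.
  have [i _ Fi] : (\bigcup_i F i) (g t).1 by rewrite -TF.
  have [j _ Gj] : (\bigcup_j G j) (g t).2 by rewrite -TG.
  exists (maxn i j) => //; split.
    by move: Fi; exact/subsetPset/ndF/leq_maxl.
  by move: Gj; exact/subsetPset/ndG/leq_maxr.
move=> i; have [mF Fi] := Foo i; have [mG Gi] := Goo i; split.
  by rewrite -[_ @^-1` _]setTI; apply: mg => //; exact: measurableX.
rewrite /lebesgue_cons /pushforward -comp_preimage.
rewrite (_ : g \o _ = id); last exact/funext.
by rewrite preimage_id product_measure1E// lte_mul_pinfty// ge0_fin_numE.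
Qed.

HB.instance Definition _ :=
  Measure_isSigmaFinite.Build _ _ _ lebesgue_cons lebesgue_cons_sigma_finite.

End step.

Fixpoint lebesgue_tuple (n : nat) :
    {sigma_finite_measure set (n.-tuple T) -> \bar R} :=
  if n is m.+1 then lebesgue_cons (lebesgue_tuple m)
  else \d_([tuple] : 0.-tuple T).

End lebesgue_tuple.

Section cube.
Context {R : realType} {n : nat}.
Implicit Types (f h : 'rV[R]_n -> R) (x : 'rV[R]_n) (i : 'I_n).

Definition cube : set 'rV[R]_n := [set x | forall i, 0 <= x ord0 i <= 1].

Definition cube_integral f : R :=
  \int[lebesgue_tuple n]_(t in [set t | cube (\row_i tnth t i)])
    f (\row_i tnth t i).

(* For functions continuous on the cube, a nonempty compact set, the set below is
   nonempty and bounded, so sup is the genuine supremum. *)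
Definition sup_norm f : R := sup [set `|f x| | x in cube].

(* Difference quotients along the i-th axis, taken inside the cube: on a face
   of the cube the corresponding limit is a one-sided one. *)
Definition partial_quotient h i x (t : R) : R :=
  t^-1 * (h (x + t *: delta_mx ord0 i) - h x).

Definition cube_steps i x : set_system R :=
  within [set t : R | cube (x + t *: delta_mx ord0 i)] 0^'.

Definition partial h i x : R :=
  lim (partial_quotient h i x t @[t --> cube_steps i x]).

Definition continuously_differentiable h : Prop :=
  forall i,
    (forall x, cube x -> cvg (partial_quotient h i x t @[t --> cube_steps i x]))
    /\ {within cube, continuous (partial h i)}.

End cube.

Section metropolis.
Context {R : realType} (n N : nat).

(* k : 'I_N stands for the integer k + 1 of {1, ..., N}. *)
Definition grid := {ffun 'I_n -> 'I_N}.

Definition grid_point (x : grid) : 'rV[R]_n :=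
  \row_i (N%:R^-1 * ((x i).+1%:R - 2^-1)).

Definition grid_dist (x y : grid) : nat :=
  (\sum_(i < n) `|(x i : nat) - (y i : nat)|)%N.

Context (f : 'rV[R]_n -> R).

Definition grid_fun (x : grid) : R := f (grid_point x).

Definition metropolis_move (x y : grid) : R :=
  if grid_dist x y == 1%N
  then (2 * n)%:R^-1 * Num.min 1 (grid_fun y / grid_fun x)
  else 0.

Definition metropolis (x y : grid) : R :=
  if x == y then 1 - \sum_(z | z != x) metropolis_move x z
  else metropolis_move x y.

End metropolis.

Section spectral_gap.
Context {R : realType}.

(* Real eigenvalues of A in nonincreasing order (rootsR is increasing), repeated
   according to their multiplicity as roots of the characteristic polynomial.
   If A is the matrix of a kernel reversible with respect to a positive measure
   pi, it is self-adjoint on L^2(pi), so this is its whole spectrum, and these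
   multiplicities are the dimensions of the eigenspaces. *)
Definition eigenvalues m (A : 'M[R]_m) : seq R :=
  flatten [seq nseq (mup a (char_poly A)) a
          | a <- rev (rootsR (char_poly A))].

Definition kernel_mx (S : finType) (K : S -> S -> R) : 'M[R]_#|S| :=
  \matrix_(i, j) K (enum_val i) (enum_val j).

(* Index 1 is the second largest eigenvalue, index 0 the largest one. *)
Definition spectral_gap (S : finType) (K : S -> S -> R) : R :=
  1 - (eigenvalues (kernel_mx K))`_1.

End spectral_gap.

(* Main.v *)
(* Join two grid points x, y by a path that rounds the segment [x, y], updating
   one coordinate at a time; it has at most nN steps.  Its vertices lie within
   2/N of the segment and |grad log f| <= A <= N, so quasi-concavity gives
   F >= eps e^(-2n) min(F x, F y) along it.  Comparing f with its values at the
   cell centres gives |f|_oo N^n <= (e^n / eta) sum F, so that F x F y is at most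
   a constant times N^(-n) (sum F) F(edge) for every edge of the path.  A given
   edge is the k-th one for at most (2N)^n pairs (x, y), since one endpoint and
   the edge determine the other endpoint up to rounding when the former is the
   farther one in time.  Cauchy-Schwarz then yields a Poincare inequality with
   constant O(N^2), which bounds the eigenvalues other than 1; since eigenvalues
   are counted with their multiplicities in the characteristic polynomial, it
   remains to see that 1 is a simple root of it. *)

Require Import Defs.
From HB Require Import structures.
From mathcomp Require Import all_boot all_order all_algebra.
From mathcomp Require Import all_classical all_reals all_analysis.
From mathcomp Require Import measurable_realfun polyrcf zify ring lra.

Import Order.TTheory GRing.Theory Num.Theory.
Import numFieldNormedType.Exports.

Local Open Scope classical_set_scope.
Local Open Scope ring_scope.

Set Implicit Arguments.
Unset Strict Implicit.
Unset Printing Implicit Defensive.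

(** * Poincare inequality and spectral gap *)

(** Sorts the ways in which index 1 of [eigenvalues] can be filled: the list is too short, a root is
    repeated, or a root after the first one comes up. *)
Lemma nth_flatten_second (T : eqType) (x0 : T) (m : T -> nat) (s : seq T) :
  uniq s -> let b := nth x0 (flatten [seq nseq (m a) a | a <- s]) 1 in
  [\/ b = x0, exists2 a, b = a & (a \in s) && (1 < m a)%N |
      exists a t, s = a :: t /\ b \in t].
Proof.
case: s => [|a s] /=; first by constructor 1.
have rest i : let c := nth x0 (flatten [seq nseq (m b) b | b <- s]) i in
    c = x0 \/ c \in s.
  move=> c; have [|le] := ltnP i (size (flatten [seq nseq (m b) b | b <- s])).
    move=> /(mem_nth x0) /flattenP[l /mapP[b bs ->]] /nseqP[e _].
    by right; rewrite /c e.
  by left; rewrite /c nth_default.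
move=> _; case E : (m a) => [|[|k]] /=; last first.
- by constructor 2; exists a => //; rewrite mem_head E.
- have [->|H] := rest 0%N; [by constructor 1|constructor 3].
  by exists a, s.
- have [->|H] := rest 1%N; [by constructor 1|constructor 3].
  by exists a, s.
Qed.

Lemma char_poly_tr (F : fieldType) m (A : 'M[F]_m) : char_poly A^T = char_poly A.
Proof.
rewrite /char_poly -[RHS]det_tr; congr (\det _).
by apply/matrixP => i j; rewrite !mxE eq_sym.
Qed.

Lemma mem_rootsR (R : rcfType) (p : {poly R}) :
  p != 0 -> forall x, (x \in rootsR p) = root p x.
Proof. by move=> p0 x; rewrite -(roots_on_rootsR p0 x) in_itv. Qed.

(** * Double root 1 of a characteristic polynomial *)

Section char_poly_one.
Context {F : fieldType} {m : nat} (A : 'M[F]_m).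
Hypothesis A1 : A *m const_mx 1 = const_mx 1 :> 'cV_m.

(* The adjugate satisfies [\adj D *m D = \det D] for [D = 'X - A], and
   [D *m 1 = ('X - 1) *: 1]; so [\adj D *m 1] is the quotient of [char_poly A]
   by ['X - 1], which vanishes at 1 when 1 is a double root. *)
Lemma mup1_adj : (1 < mup 1 (char_poly A))%N ->
  \adj (1%:M - A) *m const_mx 1 = 0 :> 'cV_m.
Proof.
move=> m2; pose D := char_poly_mx A; pose e : 'cV[{poly F}]_m := const_mx 1.
have De : D *m e = ('X - 1%:P) *: e.
  have : map_mx (@polyC F) A *m e = e.
    have := congr1 (map_mx (@polyC F)) A1.
    by rewrite map_mxM map_const_mx.
  rewrite /D /char_poly_mx mulmxBl => ->.
  by rewrite mul_scalar_mx scalerBl scale1r.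
have E : char_poly A *: e = ('X - 1%:P) *: (\adj D *m e).
  by rewrite scalemxAr -De mulmxA mul_adj_mx mul_scalar_mx.
have : ('X - 1%:P) ^+ 2 %| char_poly A.
  by rewrite -mup_geq// monic_neq0// char_poly_monic.
move=> /dvdpP[q qE]; apply/matrixP => i j.
have /matrixP/(_ i j) := E; rewrite [in LHS]mxE [in RHS]mxE mxE mulr1 qE.
rewrite expr2 mulrA mulrC => /(mulfI (negbT (polyXsubC_eq0 1))).
move=> /(congr1 (horner_eval 1)).
rewrite /horner_eval !hornerE subrr mulr0 => /esym.
(* Evaluation at 1 is a ring morphism sending ['X - A] to [1 - A], so it commutes with the
   adjugate. *)
have -> : \adj (1%:M - A) *m const_mx 1 = map_mx (horner_eval 1) (\adj D *m e).
  rewrite map_mxM map_const_mx map_mx_adj; congr (\adj _ *m _).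
    apply/matrixP => k l; rewrite /D /char_poly_mx !mxE /= /horner_eval.
    by rewrite !(hornerE, hornerMn).
  by apply/matrixP => k l; rewrite !mxE /= /horner_eval hornerE.
by rewrite !mxE.
Qed.

(* Expanding along the column [i0], the [i0] entry of [\adj (1 - A) *m 1] is the
   determinant of [1 - A] with that column replaced by ones. *)
Lemma mup1_eigen (i0 : 'I_m) : (1 < mup 1 (char_poly A))%N ->
  exists (c : F) (v : 'cV[F]_m),
    [/\ c *: const_mx 1 + (1%:M - A) *m v = 0, v i0 0 = 0 & (c != 0) || (v != 0)].
Proof.
move=> /mup1_adj H.
pose D := 1%:M - A; pose D' := \matrix_(i, j) if j == i0 then 1 else D i j.
have detD' : \det D' = 0.
  rewrite (expand_det_col _ i0).
  have /matrixP/(_ i0 0) := H; rewrite !mxE => {}H; rewrite -[RHS]H.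
  apply: eq_bigr => i _; rewrite !mxE eqxx mul1r mulr1.
  congr (_ * \det _); apply/matrixP => k l.
  by rewrite !mxE eq_sym (negbTE (neq_lift _ _)).
have /det0P[w w0 wD] : \det D'^T == 0 by rewrite det_tr detD'.
(* [D'] kills [w], and its column [i0] consists of ones: [w 0 i0] becomes the scalar, the other
   coordinates form [v]. *)
exists (w 0 i0), (\col_i if i == i0 then 0 else w 0 i); split.
- apply/matrixP => i j; have /matrixP/(_ 0 i) := wD.
  rewrite !mxE (bigD1 i0)//= !mxE eqxx => wE; rewrite -[RHS]wE; congr (_ + _).
  rewrite [LHS](bigD1 i0)//= !mxE eqxx mulr0 add0r.
  by apply: eq_bigr => k ki0; rewrite !mxE (negbTE ki0) mulrC.
- by rewrite mxE eqxx.
- apply: contraNT w0; rewrite negb_or !negbK => /andP[/eqP c0 /eqP v0].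
  apply/eqP/matrixP => i j; rewrite ord1 mxE.
  have [->//|ii0] := eqVneq j i0.
  by have /matrixP/(_ j 0) := v0; rewrite !mxE (negbTE ii0).
Qed.

End char_poly_one.

(** * Spectrum of a reversible kernel satisfying a Poincare inequality *)

Section reversible_gap.
Context {R : realType} (S : finType) (K : S -> S -> R) (w : S -> R) (c : R).
Hypothesis w_gt0 : forall x, 0 < w x.
Hypothesis K_rev : forall x y, w x * K x y = w y * K y x.
Hypothesis K_sum : forall x, \sum_y K x y = 1.
Hypothesis c_gt0 : 0 < c.
Hypothesis c_le1 : c <= 1.
Hypothesis poincare : forall g : S -> R,
  c * (\sum_x \sum_y w x * w y * (g x - g y) ^+ 2) <=
  (\sum_x w x) * (\sum_x \sum_y w x * K x y * (g x - g y) ^+ 2).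
Variable x0 : S.

Let Z := \sum_x w x.

Let Z_gt0 : 0 < Z.
Proof.
by rewrite /Z (bigD1 x0)//= ltr_pwDl// sumr_ge0// => i _; exact: ltW.
Qed.

(** Detailed balance: after exchanging the sums, only a row sum of [K] remains. *)
Lemma invariant_weight (g : S -> R) :
  \sum_x w x * (\sum_y K x y * g y) = \sum_y w y * g y.
Proof.
under eq_bigr => x _ do rewrite mulr_sumr.
rewrite exchange_big/=; apply: eq_bigr => y _.
under eq_bigr => x _ do rewrite mulrA K_rev mulrAC.
by rewrite -mulr_sumr K_sum mulr1.
Qed.

Lemma dirichlet_eigen (g : S -> R) b : (forall x, \sum_y K x y * g y = b * g x) ->
  \sum_x \sum_y w x * K x y * (g x - g y) ^+ 2 =
  2 * (1 - b) * \sum_x w x * g x ^+ 2.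
Proof.
move=> gE.
have -> : \sum_x \sum_y w x * K x y * (g x - g y) ^+ 2 =
    \sum_x w x * g x ^+ 2 * (\sum_y K x y)
    + \sum_x w x * (\sum_y K x y * g y ^+ 2)
    - 2 * \sum_x w x * g x * (\sum_y K x y * g y).
  rewrite mulr_sumr -big_split -sumrB/=; apply: eq_bigr => x _.
  rewrite !mulr_sumr -big_split -sumrB/=; apply: eq_bigr => y _; ring.
rewrite (invariant_weight (fun y => g y ^+ 2)).
under eq_bigr => x _ do rewrite K_sum mulr1.
under [X in _ - 2 * X]eq_bigr => x _ do rewrite gE.
have -> : \sum_x w x * g x * (b * g x) = b * \sum_x w x * g x ^+ 2.
  by rewrite mulr_sumr; apply: eq_bigr => x _; ring.
ring.
Qed.

Lemma variance_sum (g : S -> R) : \sum_x \sum_y w x * w y * (g x - g y) ^+ 2 =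
  2 * Z * (\sum_x w x * g x ^+ 2) - 2 * (\sum_x w x * g x) ^+ 2.
Proof.
have -> : \sum_x \sum_y w x * w y * (g x - g y) ^+ 2 =
    \sum_x w x * g x ^+ 2 * Z + \sum_x w x * (\sum_y w y * g y ^+ 2)
    - 2 * \sum_x w x * g x * (\sum_y w y * g y).
  rewrite mulr_sumr -big_split -sumrB/=; apply: eq_bigr => x _.
  rewrite /Z !mulr_sumr -big_split -sumrB/=; apply: eq_bigr => y _; ring.
by rewrite -!mulr_suml -/Z; ring.
Qed.

Lemma weighted_sq_gt0 (g : S -> R) x : g x != 0 -> 0 < \sum_x w x * g x ^+ 2.
Proof.
move=> gx; rewrite (bigD1 x)//= ltr_pwDl//.
  by rewrite mulr_gt0// exprn_even_gt0.
by apply: sumr_ge0 => y _; rewrite mulr_ge0 ?sqr_ge0// ltW.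
Qed.

Lemma eigenvalue_le1 (g : S -> R) b x : g x != 0 ->
  (forall x, \sum_y K x y * g y = b * g x) -> b <= 1.
Proof.
move=> gx gE; have := poincare g; rewrite (dirichlet_eigen gE) => H.
have W := weighted_sq_gt0 gx.
have : 0 <= c * (\sum_x0 \sum_y w x0 * w y * (g x0 - g y) ^+ 2).
  rewrite mulr_ge0 ?(ltW c_gt0)//; apply: sumr_ge0 => i _; apply: sumr_ge0 => j _.
  by rewrite mulr_ge0 ?sqr_ge0// mulr_ge0// ltW.
move=> /le_trans/(_ H); rewrite pmulr_rge0// pmulr_lge0// pmulr_rge0//; lra.
Qed.

(** Invariance of [w] forces [g] to have mean zero when [b] is not 1. With [W] the weighted sum of
    squares, the variance is then [2 * Z * W] and the Dirichlet form [2 * (1 - b) * W]. *)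
Lemma eigenvalue_gap (g : S -> R) b x : g x != 0 -> b != 1 ->
  (forall x, \sum_y K x y * g y = b * g x) -> c <= 1 - b.
Proof.
move=> gx b1 gE; have W := weighted_sq_gt0 gx.
have g0 : \sum_x w x * g x = 0.
  have := invariant_weight g; under eq_bigr => y _ do rewrite gE mulrCA.
  rewrite -mulr_sumr => /eqP.
  rewrite -subr_eq0 -{2}[\sum_y _]mul1r -mulrBl mulf_eq0 subr_eq0 (negbTE b1).
  by move=> /= /eqP.
have := poincare g; rewrite (dirichlet_eigen gE) variance_sum g0 expr0n/=.
rewrite mulr0 subr0 -/Z.
have -> : Z * (2 * (1 - b) * \sum_x w x * g x ^+ 2) =
  (1 - b) * (2 * Z * \sum_x w x * g x ^+ 2) by ring.
by rewrite ler_pM2r// !mulr_gt0.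
Qed.

(** The Dirichlet form of [g] vanishes, so the Poincare inequality kills every term of the
    variance. *)
Lemma harmonic_const (g : S -> R) x y :
  (forall x, \sum_y K x y * g y = g x) -> g x = g y.
Proof.
move=> gE; have gE' z : \sum_y K z y * g y = 1 * g z by rewrite mul1r.
have := poincare g; rewrite (dirichlet_eigen gE') subrr mulr0 mul0r mulr0.
rewrite pmulr_rle0// => H.
have nn i j : 0 <= w i * w j * (g i - g j) ^+ 2.
  by rewrite mulr_ge0 ?sqr_ge0// mulr_ge0// ltW.
apply/eqP; rewrite -subr_eq0 -sqrf_eq0 eq_le sqr_ge0 andbT.
rewrite -(pmulr_rle0 _ (mulr_gt0 (w_gt0 x) (w_gt0 y))).
apply: le_trans H; rewrite (bigD1 x)//= (bigD1 y)//= -addrA lerDl addr_ge0//.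
  exact: sumr_ge0.
by apply: sumr_ge0 => i _; exact: sumr_ge0.
Qed.

Let A := kernel_mx K.

Let A_mul (v : 'cV[R]_#|S|) i :
  (A *m v) i 0 = \sum_y K (enum_val i) y * v (enum_rank y) 0.
Proof.
rewrite mxE (reindex (@enum_rank S)) /=; last first.
  by apply: onW_bij; exact: enum_rank_bij.
by apply: eq_bigr => y _; rewrite mxE enum_rankK.
Qed.

Lemma root_eigenfunction b : root (char_poly A) b ->
  exists (g : S -> R) (x : S), g x != 0 /\ forall x, \sum_y K x y * g y = b * g x.
Proof.
rewrite -char_poly_tr -eigenvalue_root_char => /eigenvalueP[v vE v0].
have [i vi] : exists i, v 0 i != 0.
  apply/existsP; apply: contraNT v0 => /existsPn H; apply/eqP/matrixP => i j.
  by rewrite ord1 mxE; apply/eqP; have := H j; rewrite negbK.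
exists (fun x => v 0 (enum_rank x)), (enum_val i); split; first by rewrite enum_valK.
move=> x; have /(congr1 trmx) := vE; rewrite trmx_mul trmxK => /matrixP.
move=> /(_ (enum_rank x) 0); rewrite A_mul enum_rankK !mxE => <-.
by apply: eq_bigr => y _; rewrite mxE.
Qed.

(** A double root yields a nonzero pair [a], [g] with [K g = a + g] and [g x0 = 0]. Averaging
    against [w] gives [a = 0], so [g] is harmonic, hence constant, hence zero. This excludes Jordan
    blocks as well as further eigenfunctions. *)
Lemma simple_top_eigenvalue : ~~ (1 < mup 1 (char_poly A))%N.
Proof.
apply/negP => m2.
have A1 : A *m const_mx 1 = const_mx 1 :> 'cV_#|S|.
  apply/matrixP => i j; rewrite ord1 A_mul mxE.
  by rewrite -[RHS](K_sum (enum_val i)); apply: eq_bigr => y _; rewrite mxE mulr1.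
have [a [v [E v0 nz]]] := mup1_eigen A1 (enum_rank x0) m2.
pose g x := v (enum_rank x) 0.
have gE x : \sum_y K x y * g y = a + g x.
  have /matrixP/(_ (enum_rank x) 0) := E; rewrite mulmxBl mul1mx.
  move: (A_mul v (enum_rank x)); rewrite enum_rankK => H.
  rewrite !mxE in H *; rewrite H mulr1 => /eqP.
  by rewrite addrA subr_eq0 => /eqP ->.
have a0 : a = 0.
  have := invariant_weight g; under eq_bigr => x _ do rewrite gE mulrDr.
  rewrite big_split/= => /eqP; rewrite addrC -subr_eq0 addrAC subrr add0r.
  by rewrite -mulr_suml mulf_eq0 gt_eqF//= => /eqP.
move: nz; rewrite a0 eqxx/= => /negP; apply; apply/eqP/matrixP => i j.
rewrite ord1 mxE -[i]enum_valK -[LHS]/(g _) -v0.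
by apply: harmonic_const => x; rewrite gE a0 add0r.
Qed.

Lemma spectral_gap_ge : c <= spectral_gap K.
Proof.
have p0 : char_poly A != 0 by rewrite monic_neq0// char_poly_monic.
have rR := mem_rootsR p0.
have gap b : root (char_poly A) b -> b != 1 -> c <= 1 - b.
  by move=> /root_eigenfunction[g [x [gx gE]]] b1; exact: (eigenvalue_gap gx b1 gE).
have le1 b : root (char_poly A) b -> b <= 1.
  by move=> /root_eigenfunction[g [x [gx gE]]]; exact: (eigenvalue_le1 gx gE).
have st : sorted >%R (rev (rootsR (char_poly A))).
  by rewrite rev_sorted; exact: sorted_roots.
have un : uniq (rev (rootsR (char_poly A))).
  by rewrite rev_uniq (sorted_uniq lt_trans ltxx)// sorted_roots.
rewrite /spectral_gap /eigenvalues -/A.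
have [->|[b -> ]|[a [t [sE]]]] := nth_flatten_second 0
  (fun a => mup a (char_poly A)) un.
(* Default value 0 of the list access: the gap is 1, and [c_le1] concludes. *)
- by rewrite subr0.
- rewrite mem_rev rR => /andP[rb m2]; apply: gap => //.
  by apply: contraTneq m2 => ->; exact: simple_top_eigenvalue.
- move: (nth _ _ _) => b bt; apply: gap; first by rewrite -rR -mem_rev sE inE bt orbT.
  have ra : root (char_poly A) a by rewrite -rR -mem_rev sE mem_head.
  (* The roots are listed in strictly decreasing order and the head is at most 1, so [b] is not
     1. *)
  have ab : b < a.
    move: st; rewrite sE /= path_sortedE; last by move=> x y z /[swap]; exact: lt_trans.
    by case/andP => /allP H _; exact: (H _ bt).
  by rewrite lt_eqF// (lt_le_trans ab)// le1.
Qed.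

End reversible_gap.

(** * Grid paths *)

Definition interp (N k a b : nat) : nat := (((N - k) * a + k * b) %/ N)%N.

Lemma interp_lt N k a b : (k <= N)%N -> (a < N)%N -> (b < N)%N -> (interp N k a b < N)%N.
Proof. by move=> kN aN bN; rewrite /interp ltn_divLR; nia. Qed.

Lemma interp0 N a b : (0 < N)%N -> interp N 0 a b = a.
Proof. by move=> N0; rewrite /interp subn0 mul0n addn0 mulKn. Qed.

Lemma interpN N a b : (0 < N)%N -> interp N N a b = b.
Proof. by move=> N0; rewrite /interp subnn mul0n add0n mulKn. Qed.

Lemma interp_bounds N k a b : (0 < N)%N ->
  (interp N k a b * N <= (N - k) * a + k * b < (interp N k a b).+1 * N)%N.
Proof.
by move=> N0; rewrite /interp leq_divM/= ltn_ceil.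
Qed.

(** Before rounding, the two values differ by [|b - a| / N < 1]. *)
Lemma interp_step N k a b : (k < N)%N -> (a < N)%N -> (b < N)%N ->
  (`|interp N k a b - interp N k.+1 a b| <= 1)%N.
Proof.
move=> kN aN bN; have N0 : (0 < N)%N by case: N kN aN bN.
have := interp_bounds k a b N0; have := interp_bounds k.+1 a b N0.
move: (interp N k a b) (interp N k.+1 a b) => u v.
have [m NE] : exists m, N = (k + m.+1)%N by exists (N - k.+1)%N; lia.
have -> : (N - k = m.+1)%N by lia.
have -> : (N - k.+1 = m)%N by lia.
move=> /andP[h1 h2] /andP[h3 h4].
have : (u * N < v.+1 * N + N)%N by nia.
have : (v * N < u.+1 * N + N)%N by nia.
rewrite -!mulSnr !ltn_mul2r; lia.
Qed.

(** Equal roundings force [b] and [b'] to differ by less than [N / k <= 2], and equal parity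
    excludes a difference of 1. *)
Lemma interp_inj_r N k a b b' : (k <= N)%N -> (N <= k.*2)%N -> (0 < N)%N ->
  odd b = odd b' -> interp N k a b = interp N k a b' -> b = b'.
Proof.
move=> kN Nk N0 ob e.
have := interp_bounds k a b N0; have := interp_bounds k a b' N0; rewrite e.
move: (interp _ _ _ _) ((N - k) * a)%N => u v /andP[h1 h2] /andP[h3 h4].
have hb : (k * b < k * (b' + 2))%N by nia.
have hb' : (k * b' < k * (b + 2))%N by nia.
move: hb hb'; rewrite !ltn_mul2l; lia.
Qed.

Lemma interp_sym N k a b : (k <= N)%N -> interp N k a b = interp N (N - k) b a.
Proof. by move=> kN; rewrite /interp subKn// addnC. Qed.

Lemma interp_inj_l N k a a' b : (k <= N)%N -> (k.*2 < N)%N -> (0 < N)%N ->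
  odd a = odd a' -> interp N k a b = interp N k a' b -> a = a'.
Proof.
move=> kN Nk N0 oa; rewrite !(interp_sym _ _ kN); apply: interp_inj_r => //; lia.
Qed.

Section grid_path.
Context {n N : nat}.
Implicit Types (x y z : grid n N).

Lemma ord_pos (i : 'I_N) : (0 < N)%N. Proof. by case: N i => // -[]. Qed.

(** Times beyond [N] are cut off at [N], so that path vertices are grid points for every [k]. *)
Lemma interp_ord_lt k (a b : 'I_N) : (interp N (minn k N) a b < N)%N.
Proof. by apply: interp_lt => //; exact: geq_minr. Qed.

Definition interp_ord k (a b : 'I_N) : 'I_N := Ordinal (interp_ord_lt k a b).

(* [path_time k j i] is the time reached by the coordinate [i] after [k] full
   rounds and [j] coordinate updates of the next round. *)
Definition path_time k j (i : 'I_n) : nat := if (i < j)%N then k.+1 else k.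

Definition path_vertex x y k j : grid n N :=
  [ffun i => interp_ord (path_time k j i) (x i) (y i)].

Lemma path_vertexS x y k : path_vertex x y k n = path_vertex x y k.+1 0.
Proof. by apply/ffunP => i; rewrite !ffunE /path_time ltn_ord ltn0. Qed.

Lemma path_vertex0 x y : path_vertex x y 0 0 = x.
Proof.
apply/ffunP => i; rewrite !ffunE; apply/val_inj => /=.
by rewrite /path_time ltn0 min0n interp0// (ord_pos (x i)).
Qed.

Lemma path_vertexN x y : path_vertex x y N 0 = y.
Proof.
apply/ffunP => i; rewrite !ffunE; apply/val_inj => /=.
by rewrite /path_time ltn0 minnn interpN// (ord_pos (x i)).
Qed.

Lemma grid_dist_sym x y : grid_dist x y = grid_dist y x.
Proof. by apply: eq_bigr => i _; rewrite distnC. Qed.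

Lemma grid_dist_eq0 x y : grid_dist x y = 0%N -> x = y.
Proof.
move=> /eqP; rewrite sum_nat_eq0 => /forallP H; apply/ffunP => i; apply/val_inj => /=.
by have /= := H i; lia.
Qed.

(** Only coordinate [j] is updated; rounding may leave it in place, hence an inequality. *)
Lemma path_vertex_dist x y k (j : 'I_n) : (k < N)%N ->
  (grid_dist (path_vertex x y k j) (path_vertex x y k j.+1) <= 1)%N.
Proof.
move=> kN; rewrite /grid_dist (bigD1 j)//= big1 => [|i ij]; last first.
  rewrite !ffunE /path_time ltnS [(i <= j)%N]leq_eqVlt.
  by rewrite (_ : (i == j :> nat) = false) ?distnn//; exact/negbTE.
rewrite addn0 !ffunE /path_time ltnn leqnn /= (minn_idPl (ltnW kN)) (minn_idPl kN).
exact: interp_step.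
Qed.

(* A vertex of the path together with, for each coordinate, the endpoint farther
   in time and the parity of the other one, determines both endpoints. *)
Lemma path_vertex_fiber z k j : (k < N)%N ->
  (#|[pred p : grid n N * grid n N | path_vertex p.1 p.2 k j == z]|
     <= (2 * N) ^ n)%N.
Proof.
move=> kN; have tN i : (path_time k j i <= N)%N.
  by rewrite /path_time; case: ifP => // _; exact: ltnW.
pose code (p : grid n N * grid n N) : {ffun 'I_n -> bool * 'I_N} :=
  [ffun i => if (N <= (path_time k j i).*2)%N then (odd (p.2 i), p.1 i)
             else (odd (p.1 i), p.2 i)].
have code_inj : {in [pred p | path_vertex p.1 p.2 k j == z] &, injective code}.
  move=> [x y] [x' y']; rewrite !inE /= => /eqP <- /eqP e c.
  have xy i : x i = x' i /\ y i = y' i.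
    have N0 := ord_pos (x i).
    have /(congr1 val) /= := congr1 (fun g : grid n N => g i) e.
    have := congr1 (fun g : {ffun 'I_n -> bool * 'I_N} => g i) c.
    rewrite /= !ffunE /= (minn_idPl (tN i)).
    case: leqP => [le|lt] [ab <-] h; split => //; apply/val_inj => /=.
      by symmetry; exact: interp_inj_r h.
    by symmetry; exact: interp_inj_l h.
  by congr pair; apply/ffunP => i; case: (xy i).
rewrite -(card_in_imset code_inj) (leq_trans (max_card _))//.
by rewrite card_ffun card_prod card_bool !card_ord.
Qed.

End grid_path.

(** * Poincare inequality for the Metropolis chain *)

(** Cauchy-Schwarz, as nonnegativity of the variance for the weight 1. *)
Lemma sqr_sum_le (R : realType) (I : finType) (a : I -> R) :
  (\sum_i a i) ^+ 2 <= #|I|%:R * \sum_i a i ^+ 2.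
Proof.
have := variance_sum (fun=> 1) a.
have : 0 <= \sum_x \sum_y 1 * 1 * (a x - a y) ^+ 2.
  by apply: sumr_ge0 => x _; apply: sumr_ge0 => y _; rewrite mulr1 mul1r sqr_ge0.
move=> /[swap] ->; rewrite sumr_const.
under eq_bigr do rewrite mul1r.
under [X in _ - 2 * X ^+ 2]eq_bigr do rewrite mul1r.
by move: (#|I|%:R : R) (\sum_i _) (\sum_i _) => u v t; lra.
Qed.

Section metropolis_poincare.
Context {R : realType} (n N : nat) (f : 'rV[R]_n -> R).
Let F := @grid_fun R n N f.
Hypothesis F_gt0 : forall x, 0 < F x.
Implicit Types (x y z : grid n N) (g : grid n N -> R).

(** Weighting by [F] makes the acceptance rule symmetric; this is the source of reversibility. *)
Lemma weighted_move x y : F x * metropolis_move f x y =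
  if grid_dist x y == 1%N then (2 * n)%:R^-1 * Num.min (F x) (F y) else 0.
Proof.
rewrite /metropolis_move; case: ifP => _; last by rewrite mulr0.
rewrite mulrCA; congr (_ * _).
by rewrite minr_pMr ?(ltW (F_gt0 x))// mulr1 mulrCA divff ?mulr1// gt_eqF// F_gt0.
Qed.

Lemma metropolis_rev x y : F x * metropolis f x y = F y * metropolis f y x.
Proof.
rewrite /metropolis eq_sym; have [->//|yx] := eqVneq y x.
by rewrite !weighted_move grid_dist_sym minC.
Qed.

Lemma metropolis_sum x : \sum_y metropolis f x y = 1.
Proof.
rewrite (bigD1 x)//= {1}/metropolis eqxx.
rewrite [X in _ + X](eq_bigr (metropolis_move f x)) ?subrK// => y yx.
by rewrite /metropolis eq_sym (negbTE yx).
Qed.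

(** Energy of an edge without the proposal factor [1 / (2n)]. It vanishes for [x = y], so idle steps
    of a path cost nothing. *)
Let q g x y : R := Num.min (F x) (F y) * (g x - g y) ^+ 2.

Let q_ge0 g x y : 0 <= q g x y.
Proof. by rewrite mulr_ge0 ?sqr_ge0// le_min !ltW. Qed.

Lemma metropolis_dirichlet g : (0 < n)%N ->
  \sum_x \sum_(y | grid_dist x y == 1%N) q g x y =
  (2 * n)%:R * \sum_x \sum_y F x * metropolis f x y * (g x - g y) ^+ 2.
Proof.
move=> n0; rewrite mulr_sumr; apply: eq_bigr => x _; rewrite mulr_sumr.
rewrite big_mkcond; apply: eq_bigr => y _.
have [->|xy] := eqVneq x y.
  by rewrite subrr expr0n/= !mulr0 /q subrr expr0n/= mulr0 if_same.
rewrite /metropolis (negbTE xy) weighted_move; case: ifP => _; last by rewrite mul0r mulr0.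
by rewrite -[_ * _ * _]mulrA mulVKf// pnatr_eq0 muln_eq0 -lt0n n0.
Qed.

(** Group the pairs by the vertex [z] that their path visits at time [(k, j)]. At most [(2 * N) ^ n]
    pairs share [z], and the next step of each is idle or one of the edges at [z]. *)
Lemma path_congestion g k (j : 'I_n) : (k < N)%N ->
  \sum_x \sum_y q g (path_vertex x y k j) (path_vertex x y k j.+1) <=
  ((2 * N) ^ n)%:R * \sum_x \sum_(y | grid_dist x y == 1%N) q g x y.
Proof.
move=> kN; rewrite pair_big /=.
rewrite (partition_big (fun p : grid n N * grid n N => path_vertex p.1 p.2 k j) predT)//=.
rewrite mulr_sumr; apply: ler_sum => z _.
apply: (@le_trans _ _ (\sum_(p : grid n N * grid n N | path_vertex p.1 p.2 k j == z)
   \sum_(y | grid_dist z y == 1%N) q g z y)).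
  apply: ler_sum => p /eqP pz; rewrite pz.
  have := path_vertex_dist p.1 p.2 j kN; rewrite pz leq_eqVlt ltnS leqn0.
  case/orP => [d1|/eqP/grid_dist_eq0 <-].
    by rewrite (bigD1 (path_vertex p.1 p.2 k j.+1))//= lerDl sumr_ge0.
  by rewrite {1}/q subrr expr0n/= mulr0 sumr_ge0.
rewrite sumr_const -[_ *+ _]mulr_natl ler_wpM2r ?sumr_ge0//.
by rewrite ler_nat; exact: path_vertex_fiber.
Qed.

Lemma path_telescope g x y :
  (g x - g y) ^+ 2 <= N%:R * n%:R * \sum_(k < N) \sum_(j < n)
    (g (path_vertex x y k j) - g (path_vertex x y k j.+1)) ^+ 2.
Proof.
have -> : g x - g y = - \sum_(k < N) \sum_(j < n)
    (g (path_vertex x y k j.+1) - g (path_vertex x y k j)).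
  transitivity (- \sum_(0 <= k < N)
      (g (path_vertex x y k.+1 0) - g (path_vertex x y k 0))).
    by rewrite telescope_sumr// path_vertex0 path_vertexN opprB.
  rewrite big_mkord; congr (- _); apply: eq_bigr => k _.
  rewrite -(big_mkord xpredT (fun j => g (path_vertex x y k j.+1) - g (path_vertex x y k j))).
  by rewrite telescope_sumr// path_vertexS.
rewrite sqrrN (le_trans (sqr_sum_le _))// card_ord -mulrA ler_wpM2l//.
rewrite mulr_sumr; apply: ler_sum => k _.
rewrite (le_trans (sqr_sum_le _))// card_ord ler_wpM2l//.
by apply: ler_sum => j _; rewrite -sqrrN opprB.
Qed.

(** Origin of the constant: Cauchy-Schwarz along the path costs [N * n], summing over the steps
    [N * n] again, congestion [(2 * N) ^ n], and the proposal [2 * n]. The factor [N ^ n] cancels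
    against the one in the bound on [F x]. *)
Lemma metropolis_poincare (kappa C : R) g : (0 < n)%N -> (0 < N)%N ->
  0 < kappa -> 0 < C ->
  (forall x y k j, (k < N)%N ->
     kappa * Num.min (F x) (F y) <= F (path_vertex x y k j)) ->
  (forall x, F x * N%:R ^+ n <= C * \sum_z F z) ->
  kappa / (2 ^+ n.+1 * n%:R ^+ 3 * C) / N%:R ^+ 2 *
    (\sum_x \sum_y F x * F y * (g x - g y) ^+ 2) <=
  (\sum_z F z) * (\sum_x \sum_y F x * metropolis f x y * (g x - g y) ^+ 2).
Proof.
move=> n0 N0 k0 C0 Fpath; set Z := \sum_z F z => Fmax; set E := (X in _ <= Z * X).
have Z0 : 0 <= Z by apply: sumr_ge0 => x _; rewrite ltW.
clearbody Z.
have Nn0 : 0 < N%:R ^+ n :> R by rewrite exprn_gt0// ltr0n.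
have NR : 0 < N%:R :> R by rewrite ltr0n.
have nR : 0 < n%:R :> R by rewrite ltr0n.
have pair x y k (j : 'I_n) : (k < N)%N ->
    N%:R ^+ n * kappa * (F x * F y) <=
    C * Z * Num.min (F (path_vertex x y k j)) (F (path_vertex x y k j.+1)).
  move=> kN.
  (* The product is maximum times minimum: the mass bound controls the maximum, the bound along the
     path the minimum. *)
  have -> : N%:R ^+ n * kappa * (F x * F y) =
      (Num.max (F x) (F y) * N%:R ^+ n) * (kappa * Num.min (F x) (F y)).
    by case: leP => _; ring.
  apply: ler_pM.
  - by rewrite mulr_ge0 ?(ltW Nn0)// le_max (ltW (F_gt0 x)).
  - by rewrite mulr_ge0 ?(ltW k0)// le_min !ltW.
  - by case: (leP (F x) (F y)) => _; exact: Fmax.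
  - by rewrite le_min !Fpath.
have main : N%:R ^+ n * kappa * (\sum_x \sum_y F x * F y * (g x - g y) ^+ 2) <=
    (N%:R * n%:R) * (C * Z) * \sum_(k < N) \sum_(j < n) \sum_x \sum_y
      q g (path_vertex x y k j) (path_vertex x y k j.+1).
  have -> : \sum_(k < N) \sum_(j < n) \sum_x \sum_y
      q g (path_vertex x y k j) (path_vertex x y k j.+1) =
    \sum_x \sum_y \sum_(k < N) \sum_(j < n)
      q g (path_vertex x y k j) (path_vertex x y k j.+1).
    under eq_bigr => k _ do rewrite exchange_big/=.
    rewrite exchange_big/=; apply: eq_bigr => x _.
    under eq_bigr => k _ do rewrite exchange_big/=.
    by rewrite exchange_big.
  rewrite !mulr_sumr; apply: ler_sum => x _; rewrite !mulr_sumr; apply: ler_sum => y _.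
  have h : 0 <= N%:R ^+ n * kappa * (F x * F y).
    by rewrite !mulr_ge0// ltW.
  rewrite mulrA (le_trans (ler_wpM2l h (path_telescope g x y)))//.
  rewrite mulrCA -[X in _ <= X]mulrA ler_wpM2l ?mulr_ge0//.
  rewrite !mulr_sumr; apply: ler_sum => k _; rewrite !mulr_sumr; apply: ler_sum => j _.
  by rewrite /q [X in _ <= X]mulrA ler_wpM2r ?sqr_ge0// pair.
have cong : \sum_(k < N) \sum_(j < n) \sum_x \sum_y
      q g (path_vertex x y k j) (path_vertex x y k j.+1) <=
    N%:R * n%:R * (((2 * N) ^ n)%:R * ((2 * n)%:R * E)).
  rewrite /E -metropolis_dirichlet//.
  apply: le_trans (_ : \sum_(k < N) \sum_(j < n) ((2 * N) ^ n)%:R * _ <= _).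
    by apply: ler_sum => k _; apply: ler_sum => j _; exact: path_congestion.
  by rewrite !sumr_const !card_ord -[_ *+ N]mulr_natl -[_ *+ n]mulr_natl mulrA.
have P0 : 0 <= N%:R * n%:R * (C * Z) by rewrite !mulr_ge0// ltW.
have {main cong} := le_trans main (ler_wpM2l P0 cong).
move: (\sum_x \sum_y _) => V.
have -> : N%:R * n%:R * (C * Z) * (N%:R * n%:R * (((2 * N) ^ n)%:R * ((2 * n)%:R * E)))
  = N%:R ^+ n * ((2 ^+ n.+1 * n%:R ^+ 3 * C) * N%:R ^+ 2 * (Z * E)).
  by rewrite expnMn !natrM !natrX exprS; ring.
rewrite -mulrA ler_pM2l// => H.
rewrite -[kappa / _ / _]mulrA -invfM mulrAC ler_pdivrMr; last first.
  by rewrite !mulr_gt0 ?exprn_gt0.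
by rewrite [X in _ <= X]mulrC.
Qed.

End metropolis_poincare.

(** * Logarithmic Lipschitz bounds *)

Lemma derive_quotientE (R : realType) (g : R -> R) (t : R) :
  (fun h : R => h^-1 *: ((g \o shift t) (h *: (1 : R)) - g t)) =
  (fun u => u^-1 * (g (t + u) - g t)).
Proof. by apply/funext => u; rewrite /GRing.scale/= mulr1 (addrC u). Qed.

Section log_lipschitz_itv.
Context {R : realType} (phi : R -> R) (A : R).

(** One-variable counterpart of [cube_steps]: limits along it are one-sided at 0 and 1. *)
Definition itv_steps (t : R) : set_system R :=
  within [set u | 0 <= t + u <= 1] 0^'.

Hypothesis phi_gt0 : forall t : R, 0 <= t <= 1 -> 0 < phi t.
Hypothesis phi_cvg : forall t : R, 0 <= t <= 1 ->
  cvg (u^-1 * (phi (t + u) - phi t) @[u --> itv_steps t]).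
Hypothesis ln_phi_le : forall t : R, 0 <= t <= 1 ->
  `|lim (u^-1 * (ln (phi (t + u)) - ln (phi t)) @[u --> itv_steps t])| <= A.

(** Differentiability implies continuity, since [phi s] is [phi t] plus [s - t] times the quotient.
    A general filter [G] covers the one-sided neighbourhoods at the ends of an interval. *)
Lemma cvg_from_quotient (G : set_system R) (t : R) : Filter G -> 0 <= t <= 1 ->
  G --> t -> (\forall s \near G, s != t /\ 0 <= s <= 1) -> phi @ G --> phi t.
Proof.
move=> FG t01 Gt near_t; have /cvg_ex[/= l ql] := phi_cvg t01.
have Gsteps : s - t @[s --> G] --> itv_steps t.
  move=> P; rewrite /itv_steps /within /= => nP.
  have : s - t @[s --> G] --> 0 by rewrite -(subrr t); apply: cvgB => //; exact: cvg_cst.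
  move=> /(_ _ nP)/= H; apply: filterS2 near_t H => s [st s01].
  by apply; rewrite ?subr_eq0//= addrC subrK.
have := cvg_comp _ _ Gsteps ql => /= {}ql.
have : phi t + (s - t) * ((s - t)^-1 * (phi (t + (s - t)) - phi t)) @[s --> G]
    --> phi t + (t - t) * l.
  apply: cvgD; first exact: cvg_cst.
  by apply: cvgM => //; apply: cvgB => //; exact: cvg_cst.
rewrite subrr mul0r addr0; apply: cvg_trans; apply: near_eq_cvg.
apply: filterS near_t => s [st _] /=.
by rewrite mulVKf ?subr_eq0// (addrC t) subrK addrC subrK.
Qed.

Lemma itv_steps_interior (t : R) : 0 < t < 1 -> itv_steps t = 0^'.
Proof.
move=> /andP[t0 t1]; rewrite /itv_steps; apply/seteqP; split => P; rewrite /within/=.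
  have : \forall u \near (0 : R)^', 0 <= t + u <= 1.
    exists (Num.min t (1 - t)); first by rewrite /= lt_min t0 subr_gt0.
    move=> u /=; rewrite sub0r normrN lt_min => /andP[+ +] _.
    by rewrite !ltr_norml; lra.
  by move=> H1 H2; apply: filterS2 H1 H2 => u H /(_ H).
by apply: filterS => u Pu _.
Qed.

(** A bound on a [lim] is informative only with convergence. The chain rule supplies it, and the
    derivative is then this limit by definition. *)
Lemma is_derive_ln_phi (t : R) : 0 < t < 1 ->
  is_derive t 1 (@ln R \o phi)
    (lim (u^-1 * (ln (phi (t + u)) - ln (phi t)) @[u --> itv_steps t])).
Proof.
move=> t01; have t01' : 0 <= t <= 1 by case/andP: t01 => *; rewrite !ltW.
have dphi : derivable phi t 1.
  have := phi_cvg t01'; rewrite (itv_steps_interior t01).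
  by rewrite /derivable derive_quotientE.
have dln : derivable (@ln R \o phi) t 1.
  have [] // := is_derive1_comp (is_derive1_ln (phi_gt0 t01')) (derivableP dphi).
rewrite (itv_steps_interior t01); apply: DeriveDef => //.
by rewrite /derive derive_quotientE.
Qed.

Lemma ln_phi_lipschitz (s t : R) : 0 <= s <= 1 -> 0 <= t <= 1 ->
  `|ln (phi t) - ln (phi s)| <= A * `|t - s|.
Proof.
wlog st : s t / s < t.
  move=> H s01 t01; have [st|ts|->] := ltgtP s t; first exact: H.
    by rewrite distrC (distrC t); exact: H.
  by rewrite !subrr normr0 mulr0.
move=> s01 t01; have /andP[s0 s1] := s01; have /andP[t0 t1] := t01.
pose df r := lim (u^-1 * (ln (phi (r + u)) - ln (phi r)) @[u --> itv_steps r]).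
have dh r : r \in `]s, t[%R -> is_derive r 1 (@ln R \o phi) (df r).
  by rewrite in_itv/= => /andP[sr rt]; apply: is_derive_ln_phi; lra.
have cln r : 0 <= r <= 1 -> {for phi r, continuous (@ln R)}.
  by move=> r01; apply: continuous_ln; exact: phi_gt0.
(* The mean value theorem needs continuity up to [s] and [t], which may be 0 and 1, where only
   one-sided quotients are available. *)
have ch : {within `[s, t], continuous (@ln R \o phi)}.
  apply/continuous_within_itvP => //; split.
  - move=> r rst; apply: differentiable_continuous; apply/derivable1_diffP.
    by have [] := dh r rst.
  - suff ps : phi r @[r --> s^'+] --> phi s.
      by apply: (cvg_comp _ _ ps); exact: (cln s s01).
    apply: cvg_from_quotient; [lra|exact: cvg_within|].
    near=> r; have sr : s < r by near: r; exact: nbhs_right_gt.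
    have rt : r < t by near: r; exact: nbhs_right_lt.
    by split; [rewrite gt_eqF|lra].
  - suff pt : phi r @[r --> t^'-] --> phi t.
      by apply: (cvg_comp _ _ pt); exact: (cln t t01).
    apply: cvg_from_quotient; [lra|exact: cvg_within|].
    near=> r; have rt : r < t by near: r; exact: nbhs_left_lt.
    have sr : s < r by near: r; exact: nbhs_left_gt.
    by split; [rewrite lt_eqF|lra].
have [r rst /= ->] := MVT st dh ch.
rewrite normrM ler_wpM2r// ln_phi_le//.
by move: rst; rewrite in_itv/=; lra.
Unshelve. all: by end_near.
Qed.

End log_lipschitz_itv.

Section log_lipschitz_cube.
Context {R : realType} {n : nat} (f : 'rV[R]_n -> R) (A : R).
Implicit Types x y : 'rV[R]_n.
Hypothesis f_gt0 : forall x, cube x -> 0 < f x.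
Hypothesis f_diff : continuously_differentiable f.
Hypothesis f_partial : forall x i,
  cube x -> `|partial (fun y => ln (f y)) i x| <= A.

Definition set_coord x (i : 'I_n) (t : R) : 'rV[R]_n :=
  \row_j if j == i then t else x 0 j.

Lemma cube_set_coord x i t : cube x -> cube (set_coord x i t) <-> 0 <= t <= 1.
Proof.
move=> cx; split=> [/(_ i)|t01 j]; first by rewrite mxE eqxx.
by rewrite mxE; case: ifP.
Qed.

Lemma set_coordD x i t u :
  set_coord x i t + u *: delta_mx ord0 i = set_coord x i (t + u).
Proof.
apply/matrixP => a j; rewrite (ord1 a) !mxE eqxx/=.
by case: eqVneq => _; rewrite ?mulr1// mulr0 addr0.
Qed.

Lemma partial_quotient_coord (h : 'rV[R]_n -> R) x i t :
  partial_quotient h i (set_coord x i t) =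
  (fun u => u^-1 * (h (set_coord x i (t + u)) - h (set_coord x i t))).
Proof. by apply/funext => u; rewrite /partial_quotient set_coordD. Qed.

Lemma cube_steps_coord x i t : cube x ->
  cube_steps i (set_coord x i t) = itv_steps t.
Proof.
move=> cx; rewrite /cube_steps.
have -> // : [set u : R | cube (set_coord x i t + u *: delta_mx ord0 i)] =
    [set u | 0 <= t + u <= 1].
by apply/funext => u /=; rewrite set_coordD; apply/propext; exact: cube_set_coord.
Qed.

Lemma ln_coord_lipschitz x i s t : cube x -> 0 <= s <= 1 -> 0 <= t <= 1 ->
  `|ln (f (set_coord x i t)) - ln (f (set_coord x i s))| <= A * `|t - s|.
Proof.
move=> cx s01 t01; apply: (@ln_phi_lipschitz _ (fun t => f (set_coord x i t))) => // r r01.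
- by apply: f_gt0; apply/cube_set_coord.
- have cr : cube (set_coord x i r) by apply/cube_set_coord.
  have [/(_ _ cr) + _] := f_diff i.
  by rewrite partial_quotient_coord (cube_steps_coord _ _ cx).
- have cr : cube (set_coord x i r) by apply/cube_set_coord.
  have := f_partial i cr; rewrite /partial.
  by rewrite partial_quotient_coord (cube_steps_coord _ _ cx).
Qed.

(** Move from [x] to [y] one coordinate at a time; the intermediate points [z k] stay in the
    cube. *)
Lemma ln_lipschitz x y : cube x -> cube y ->
  `|ln (f y) - ln (f x)| <= A * \sum_i `|y 0 i - x 0 i|.
Proof.
move=> cx cy; pose z k : 'rV[R]_n := \row_i if (i < k)%N then y 0 i else x 0 i.
have cz k : cube (z k) by move=> i; rewrite mxE; case: ifP.
have -> : ln (f y) - ln (f x) = \sum_(i < n) (ln (f (z i.+1)) - ln (f (z i))).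
  rewrite -(big_mkord xpredT (fun i => ln (f (z i.+1)) - ln (f (z i)))).
  rewrite telescope_sumr//; congr (ln (f _) - ln (f _)).
    by apply/matrixP => a j; rewrite ord1 mxE ltn_ord.
  by apply/matrixP => a j; rewrite ord1 mxE ltn0.
rewrite (le_trans (ler_norm_sum _ _ _))// mulr_sumr; apply: ler_sum => i _.
have -> : z i.+1 = set_coord (z i) i (y 0 i).
  apply/matrixP => a j; rewrite ord1 !mxE ltnS leq_eqVlt.
  by have [->|ji] := eqVneq j i; rewrite ?eqxx// (negbTE (_ : _ != _ :> nat)).
have {2}-> : z i = set_coord (z i) i (x 0 i).
  apply/matrixP => a j; rewrite ord1 !mxE.
  by have [->|ji] := eqVneq j i; rewrite ?ltnn.
exact: ln_coord_lipschitz.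
Qed.

Lemma cube_ratio_le x y (D : R) : cube x -> cube y ->
  A * (\sum_i `|y 0 i - x 0 i|) <= D -> f y <= expR D * f x.
Proof.
move=> cx cy AD; have fx := f_gt0 cx; have fy := f_gt0 cy.
rewrite -(lnK (fy : f y \is Num.pos)) -[X in _ * X](lnK (fx : f x \is Num.pos)).
rewrite -expRD ler_expR -lerBlDr (le_trans (ler_norm _))//.
exact: le_trans (ln_lipschitz cx cy) AD.
Qed.

End log_lipschitz_cube.

(** * Riemann sums *)

Section boxes.
Context {R : realType}.

Definition box (n : nat) (a b : 'I_n -> R) : set (n.-tuple (measurableTypeR R)) :=
  [set t | forall i, a i <= tnth t i <= b i].

Lemma measurable_box n (a b : 'I_n -> R) : measurable (box a b).
Proof.
have -> : box a b = \bigcap_(i in [set: 'I_n])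
    ((fun t : n.-tuple (measurableTypeR R) => tnth t i) @^-1` `[a i, b i]%classic).
  apply/seteqP; split => t /= H.
    by move=> i _ /=; rewrite in_itv/=; exact: H.
  by move=> i; have := H i I; rewrite /= in_itv.
apply: fin_bigcap_measurable => // i _; rewrite -[_ @^-1` _]setTI.
exact: measurable_tnth.
Qed.

(** Induction on the dimension: the preimage of a box under [cons_pair] is an interval times a
    box. *)
Lemma lebesgue_tuple_box n (a b : 'I_n -> R) : (forall i, a i <= b i) ->
  lebesgue_tuple n (box a b) = (\prod_i (b i - a i))%:E.
Proof.
elim: n a b => [|n IH] a b ab.
  rewrite big_ord0 /= diracE mem_set//.
  by case.
rewrite big_ord_recl EFinM -IH//=.
pose a' i := a (lift ord0 i); pose b' i := b (lift ord0 i).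
rewrite /lebesgue_cons /pushforward.
have -> : @cons_pair R n @^-1` box a b = `[a ord0, b ord0]%classic `*` box a' b'.
  apply/seteqP; split => -[s t] /=.
    move=> H; split; first by have := H ord0; rewrite tnth0 /= in_itv.
    by move=> i; have := H (lift ord0 i); rewrite tnthS.
  move=> [/=]; rewrite in_itv/= => H0 H i.
  by case: (unliftP ord0 i) => [j ->|->]; rewrite ?tnth0 ?tnthS//; exact: H.
rewrite product_measure1E//; last exact: measurable_box.
congr (_ * _)%E; apply: etrans (lebesgue_measure_itv `[a ord0, b ord0]) _.
rewrite /= lte_fin.
by case: ltgtP (ab ord0) => // -> _; rewrite subrr.
Qed.

End boxes.

(** Read off from the integral as a supremum over simple functions below the integrand, an argument
    that never mentions measurability. *)
Lemma nonneg_integral_le d (T : measurableType d) (R : realType)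
    (mu : {measure set T -> \bar R}) (D : set T) (f g : T -> \bar R) :
  (forall t, D t -> (0 <= f t)%E) -> (forall t, (0 <= g t)%E) ->
  (forall t, D t -> (f t <= g t)%E) ->
  (\int[mu]_(t in D) f t <= \int[mu]_t g t)%E.
Proof.
move=> f0 g0 fg; rewrite ge0_integralE// ge0_integralTE//.
apply: le_ereal_sup => _ [h /= hf <-]; exists h => // t.
apply: le_trans (hf t) _; rewrite /patch; case: ifPn => //.
by rewrite inE => /fg.
Qed.

Section riemann_sum.
Context {R : realType} (n N : nat) (f : 'rV[R]_n -> R) (C : R).
Hypothesis N_gt0 : (0 < N)%N.

Let cell (x : grid n N) : set (n.-tuple (measurableTypeR R)) :=
  box (fun i => (x i)%:R / N%:R) (fun i => (x i).+1%:R / N%:R).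

Let NR : 0 < N%:R :> R. Proof. by rewrite ltr0n. Qed.

Lemma cell_cover t : cube (\row_i tnth t i) -> exists x : grid n N, cell x t.
Proof.
move=> ct; have ti i : 0 <= (tnth t i : R) <= 1 by have := ct i; rewrite mxE.
have /choice[k kP] : forall i, exists k : 'I_N,
    k%:R / N%:R <= (tnth t i : R) <= k.+1%:R / N%:R.
  move=> i; have /andP[t0 t1] := ti i.
  have tN : 0 <= tnth t i * N%:R :> R by rewrite mulr_ge0// ltW.
  have [lt|ge] := ltnP (Num.trunc (tnth t i * N%:R : R)) N.
    exists (Ordinal lt); rewrite /= ler_pdivrMr// ler_pdivlMr//.
    by have /andP[-> /ltW ->] := truncn_itv tN.
  (* Here the coordinate equals 1, which belongs to the last closed cell. *)
  have lt : (N.-1 < N)%N by rewrite prednK.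
  exists (Ordinal lt); rewrite /= prednK// divff ?gt_eqF// t1 andbT.
  rewrite ler_pdivrMr//.
  have /andP[+ _] := truncn_itv tN; apply: le_trans.
  by rewrite ler_nat (leq_trans _ ge)// leq_pred.
by exists [ffun i => k i] => i; rewrite ffunE.
Qed.

(** The sum of [C * grid_fun f x] times the indicator of each cell dominates [f], and a cell has
    volume [N ^ -n]. Overlaps of closed cells only increase this upper bound. *)
Lemma cube_integral_le :
  (forall x, cube x -> 0 <= f x) ->
  (forall (x : grid n N) (y : 'rV[R]_n), cube y ->
     (forall i, (x i)%:R / N%:R <= y 0 i <= (x i).+1%:R / N%:R) ->
     f y <= C * grid_fun f x) ->
  (forall x : grid n N, 0 <= C * grid_fun f x) ->
  cube_integral f * N%:R ^+ n <= C * \sum_(x : grid n N) grid_fun f x.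
Proof.
move=> f0 fC C0; pose I (x : grid n N) (t : n.-tuple (measurableTypeR R)) : \bar R :=
  ((C * grid_fun f x)%:E * (\1_(cell x) t)%:E)%E.
have I0 x t : (0 <= I x t)%E by rewrite mule_ge0// lee_fin ?C0.
pose D : set (n.-tuple (measurableTypeR R)) := [set t | cube (\row_i tnth t i)].
have int_le : (\int[lebesgue_tuple n]_(t in D) (f (\row_i tnth t i))%:E <=
    ((C * \sum_(x : grid n N) grid_fun f x) / N%:R ^+ n)%:E)%E.
  have : (\int[lebesgue_tuple n]_(t in D) (f (\row_i tnth t i))%:E <=
      \int[lebesgue_tuple n]_t (\sum_(x : grid n N) I x t))%E.
    apply: nonneg_integral_le.
    - by move=> t ct; rewrite lee_fin f0.
    - by move=> t; exact: sume_ge0.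
    - move=> t ct; have [x xt] := cell_cover ct.
      rewrite (bigD1 x)//= -[X in (X <= _)%E]adde0 leeD//; last exact: sume_ge0.
      rewrite /I indicE mem_set// mule1 lee_fin fC// => i.
      by rewrite mxE; exact: xt.
  move=> /le_trans; apply.
  rewrite ge0_integral_sum//; last first.
    move=> x; apply: measurable_funeM; apply/measurable_EFinP.
    by apply: measurable_indic; exact: measurable_box.
  rewrite mulr_sumr mulr_suml -sumEFin lee_sum// => x _.
  rewrite ge0_integralZl_EFin ?C0//; last first.
    by apply/measurable_EFinP; apply: measurable_indic; exact: measurable_box.
  suff -> : (\int[lebesgue_tuple n]_t (\1_(cell x) t)%:E = (N%:R ^+ n)^-1%:E)%E.
    by rewrite -EFinM.
  rewrite integral_indic ?setIT//; last exact: measurable_box.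
  apply: etrans (lebesgue_tuple_box _) _.
    by move=> i; rewrite ler_pM2r ?invr_gt0// ler_nat.
  under eq_bigr do rewrite -mulrBl -natrB// subSnn mul1r.
  by rewrite prodr_const card_ord exprVn.
have int_ge0 : (0 <= \int[lebesgue_tuple n]_(t in D) (f (\row_i tnth t i))%:E)%E.
  by apply: integral_ge0 => t ct; rewrite lee_fin f0.
(* Passing to the real-valued integral requires finiteness, which [int_le] provides. *)
rewrite -ler_pdivlMr ?exprn_gt0// -lee_fin /cube_integral /Rintegral fineK//.
by rewrite ge0_fin_numE// (le_lt_trans int_le)// ltry.
Qed.

End riemann_sum.

(** * Discretization of the cube *)

(** Rounding loses less than one grid step, and advancing the time from [k] to [k.+1] moves by less
    than one more. *)
Lemma interp_near N k k' a b : (0 < N)%N -> (a < N)%N -> (b < N)%N ->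
  (k < N)%N -> (k <= k' <= k.+1)%N ->
  (interp N k' a b * N <= (N - k) * a + k * b + N)%N &&
  ((N - k) * a + k * b <= interp N k' a b * N + 2 * N)%N.
Proof.
move=> N0 aN bN kN /andP[kk' k'k].
have := interp_bounds k' a b N0; move: (interp N k' a b) => u /andP[h1 h2].
have [m NE] : exists m, N = (k + m.+1)%N by exists (N - k.+1)%N; lia.
have e1 : (N - k = m.+1)%N by lia.
have [ke|ke] : k' = k \/ k' = k.+1 by lia.
  by subst k'; rewrite e1 in h1 h2 *; apply/andP; split; nia.
have e2 : (N - k.+1 = m)%N by lia.
by subst k'; rewrite e2 in h1 h2; rewrite e1; apply/andP; split; nia.
Qed.

Section grid_points.
Context {R : realType} (n N : nat).
Hypothesis N_gt0 : (0 < N)%N.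

Let NR : 0 < N%:R :> R. Proof. by rewrite ltr0n. Qed.

Lemma cube_grid_point (x : grid n N) : cube (grid_point x : 'rV[R]_n).
Proof.
move=> i; rewrite mxE mulrC; apply/andP; split.
  by rewrite mulr_ge0 ?invr_ge0 ?(ltW NR)// -natr1; have : 0 <= (x i)%:R :> R by []; lra.
rewrite ler_pdivrMr// mul1r.
have : (x i).+1%:R <= N%:R :> R by rewrite ler_nat.
lra.
Qed.

Lemma cell_grid_point (x : grid n N) (y : 'rV[R]_n) :
  (forall i, (x i)%:R / N%:R <= y 0 i <= (x i).+1%:R / N%:R) ->
  \sum_i `|y 0 i - grid_point x 0 i| <= n%:R / N%:R.
Proof.
move=> yx; apply: (@le_trans _ _ (\sum_(i < n) N%:R^-1)).
  apply: ler_sum => i _; rewrite mxE; have := yx i.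
  rewrite ![_ / N%:R]mulrC -natr1.
  have : 0 < N%:R^-1 :> R by rewrite invr_gt0.
  by move: (N%:R^-1) => v v0; rewrite ler_norml; nra.
by rewrite sumr_const card_ord mulr_natl.
Qed.

Lemma path_vertex_near (x y : grid n N) k j : (k < N)%N ->
  \sum_i `|(grid_point x + (k%:R / N%:R) *: (grid_point y - grid_point x) : 'rV[R]_n) 0 i
            - grid_point (path_vertex x y k j) 0 i| <= n%:R * 2 / N%:R.
Proof.
move=> kN; apply: (@le_trans _ _ (\sum_(i < n) (2 / N%:R))).
  apply: ler_sum => i _; rewrite !mxE !ffunE /=.
  set k' := minn _ _.
  have kk' : (k <= k' <= k.+1)%N by rewrite /k' /path_time; case: ifP; lia.
  have /andP[] := interp_near N_gt0 (ltn_ord (x i)) (ltn_ord (y i)) kN kk'.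
  move: (interp _ _ _ _) => p.
  rewrite -!(ler_nat R) !natrD !natrM natrB ?(ltnW kN)// -(@natr1 _ (x i)) -(@natr1 _ (y i)) -(@natr1 _ p).
  move: ((x i)%:R : R) ((y i)%:R : R) (p%:R : R) (k%:R : R) => a b q s h1 h2.
  (* One factor [N] clears the time [k / N], the other the mesh; the half-cell offsets cancel. *)
  rewrite -(@ler_pM2r _ (N%:R ^+ 2)) ?exprn_gt0//.
  rewrite -[X in _ * X]ger0_norm ?exprn_ge0 ?(ltW NR)// -normrM.
  have -> : (N%:R^-1 * (a + 1 - 2^-1) + s / N%:R *
     (N%:R^-1 * (b + 1 - 2^-1) - N%:R^-1 * (a + 1 - 2^-1))
      - N%:R^-1 * (q + 1 - 2^-1)) * N%:R ^+ 2 =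
      ((N%:R - s) * a + s * b) - q * N%:R.
    by field; rewrite gt_eqF.
  have -> : 2 / N%:R * N%:R ^+ 2 = 2 * N%:R :> R by field; rewrite gt_eqF.
  by rewrite ler_norml; lra.
by rewrite sumr_const card_ord -[_ *+ _]mulr_natl mulrA.
Qed.

End grid_points.

Section cube_function.
Context {R : realType} {n : nat} (f : 'rV[R]_n -> R).
Hypothesis f_inf : 0 < inf [set f x | x in cube].

(** [inf] defaults to 0 on sets without an infimum, so its positivity ensures that it is a lower
    bound. *)
Lemma cube_inf_gt0 x : cube x -> 0 < f x.
Proof.
move=> cx; have hi : has_inf [set f x | x in cube].
  by apply: contrapT => hi; have := f_inf; rewrite inf_out// ltxx.
by apply: (lt_le_trans f_inf); apply: ge_inf; [case: hi|exists x].
Qed.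

(** The bound [M], whatever its size, makes [sup] a genuine upper bound. *)
Lemma le_sup_norm M : (forall x, cube x -> f x <= M) ->
  forall x, cube x -> f x <= sup_norm f.
Proof.
move=> fM x cx; rewrite -(gtr0_norm (cube_inf_gt0 cx)).
apply: ub_le_sup; last by exists x.
by exists M => _ [y cy <-]; rewrite gtr0_norm ?fM// cube_inf_gt0.
Qed.

End cube_function.

Theorem proposition3p3 (R : realType) (eps eta : R) (n : nat) :
  0 < eps -> 0 < eta -> (2 <= n)%N ->
  exists c : R, 0 < c /\
    forall (A : R) (N : nat) (f : 'rV[R]_n -> R),
      1 <= A -> (2 <= N)%N -> A <= N%:R ->
      continuously_differentiable f ->
      0 < inf [set f x | x in cube] ->
      (forall (x : 'rV[R]_n) (i : 'I_n),
         cube x -> `|partial (fun y => ln (f y)) i x| <= A) ->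
      (forall (x y : 'rV[R]_n) (t : R),
         cube x -> cube y -> 0 <= t <= 1 ->
         eps * Num.min (f x) (f y) <= f (x + t *: (y - x))) ->
      eta * sup_norm f <= cube_integral f ->
      c / N%:R ^+ 2 <= spectral_gap (metropolis (N := N) f).
Proof.
move=> eps0 eta0 n2; have n0 : (0 < n)%N by exact: ltnW.
have nR : 0 < n%:R :> R by rewrite ltr0n.
(* [log f] varies by at most [n] between a cell and its centre, and by at most [2 * n] between a
   path vertex and the segment. *)
pose C : R := expR n%:R / eta; pose kappa : R := eps * expR (- (2 * n%:R)).
have C0 : 0 < C by rewrite divr_gt0// expR_gt0.
have k0 : 0 < kappa by rewrite mulr_gt0// expR_gt0.
pose c1 := kappa / (2 ^+ n.+1 * n%:R ^+ 3 * C).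
have c10 : 0 < c1 by rewrite divr_gt0// mulr_gt0// mulr_gt0// exprn_gt0.
(* The minimum with 1 meets the requirement of [spectral_gap_ge] that the bound be at most 1. *)
exists (Num.min 1 c1); split; first by rewrite lt_min ltr01.
move=> A N f A1 N2 AN df finf dlnf quasi mass.
have N0 : (0 < N)%N by exact: ltnW.
have NR : 0 < N%:R :> R by rewrite ltr0n.
have A0 : 0 <= A by rewrite (le_trans _ A1).
have f0 := cube_inf_gt0 finf.
have ratio x y D := @cube_ratio_le _ _ f A f0 df dlnf x y D.
(* This is where [A <= N] enters, removing [A] from the constants. *)
have AnN m : 0 <= m -> A * (m / N%:R) <= m.
  by move=> m0; rewrite mulrA ler_pdivrMr// mulrC ler_wpM2l.
have f_le x : cube x -> f x <= sup_norm f.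
  (* A crude bound from the value at the origin; it depends on [A] but serves only to show that [f]
     is bounded. *)
  apply: (@le_sup_norm _ _ _ finf (expR (A * n%:R) * f 0)) => {}x cx.
  have c0 : cube (0 : 'rV[R]_n) by move=> i; rewrite mxE lexx ler01.
  apply: ratio => //; rewrite ler_wpM2l//.
  apply: (@le_trans _ _ (\sum_(i < n) 1)); last by rewrite sumr_const card_ord.
  by apply: ler_sum => i _; rewrite mxE subr0 ger0_norm; have /andP[] := cx i.
have F0 (x : grid n N) : 0 < grid_fun f x by apply: f0; exact: cube_grid_point.
have riemann : cube_integral f * N%:R ^+ n <=
    expR n%:R * \sum_(x : grid n N) grid_fun f x.
  apply: cube_integral_le => //.
  - by move=> x /f0/ltW.
  - move=> x y cy yx; apply: ratio => //; first exact: cube_grid_point.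
    apply: le_trans (AnN _ (ltW nR)); rewrite ler_wpM2l//.
    exact: cell_grid_point.
  - by move=> x; rewrite mulr_ge0 ?expR_ge0// ltW.
have max_le (x : grid n N) :
    grid_fun f x * N%:R ^+ n <= C * \sum_(z : grid n N) grid_fun f z.
  rewrite /C mulrAC ler_pdivlMr//; apply: le_trans riemann.
  rewrite mulrAC ler_wpM2r ?exprn_ge0//; apply: le_trans mass.
  by rewrite mulrC ler_wpM2l ?(ltW eta0)// f_le//; exact: cube_grid_point.
have path_ge (x y : grid n N) k j : (k < N)%N ->
    kappa * Num.min (grid_fun f x) (grid_fun f y) <= grid_fun f (path_vertex x y k j).
  move=> kN; pose t : R := k%:R / N%:R.
  pose u : 'rV[R]_n := grid_point x + t *: (grid_point y - grid_point x).
  have t01 : 0 <= t <= 1.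
    by apply/andP; split; rewrite ?divr_ge0// ler_pdivrMr// mul1r ler_nat ltnW.
  have cx := @cube_grid_point R n N N0 x; have cy := @cube_grid_point R n N N0 y.
  have cu : cube u.
    move: t01; rewrite /u; move: (t) => r r01 i.
    have := cx i; have := cy i; rewrite !mxE.
    move: (N%:R^-1 * _) (N%:R^-1 * _) => a b; nra.
  have : f u <= expR (2 * n%:R) * grid_fun f (path_vertex x y k j).
    apply: ratio => //; first exact: cube_grid_point.
    apply: le_trans (AnN _ _); last by rewrite mulr_ge0.
    rewrite ler_wpM2l// [2 * _]mulrC; exact: path_vertex_near.
  (* Quasi-concavity bounds [f] at the point [u] of the segment; the factor [expR (- (2 * n))] in
     [kappa] pays for moving to the vertex. *)
  have := quasi _ _ _ cx cy t01; rewrite -/u => /le_trans/[apply] h.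
  rewrite -(ler_pM2l (expR_gt0 (2 * n%:R))); apply: le_trans h.
  by rewrite /kappa expRN mulrA mulrCA divff ?mulr1// gt_eqF// expR_gt0.
have Nge1 : 1 <= N%:R ^+ 2 :> R by rewrite exprn_ege1// ler1n.
apply: (@spectral_gap_ge _ _ _ (@grid_fun R n N f)) => //.
- exact: metropolis_rev.
- exact: metropolis_sum.
- by rewrite divr_gt0 ?exprn_gt0// lt_min ltr01.
- by rewrite ler_pdivrMr ?exprn_gt0// mul1r (le_trans _ Nge1)// ge_min lexx.
- move=> g; apply: le_trans (@metropolis_poincare _ _ _ _ F0 kappa C g n0 N0 k0 C0 path_ge max_le).
  rewrite ler_wpM2r//.
    apply: sumr_ge0 => x _; apply: sumr_ge0 => y _.
    by rewrite mulr_ge0 ?sqr_ge0// mulr_ge0// ltW.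
  by rewrite ler_wpM2r ?invr_ge0 ?exprn_ge0// ge_min lexx orbT.
- exact: [ffun=> Ordinal N0].
Qed.
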